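(* For every pair of integers $k \ge 1$ and $\ell \ge 2$, we have $\chi'_{st}(C_{4k} \,\square\, C_{2\ell}) = 6$.
   Context: A star edge-coloring of a graph $G$ is a proper edge-coloring of $G$ in which there is no bichromatic path and no bichromatic cycle of length four (i.e., with four edges). The star chromatic index $\chi'_{st}(G)$ is the minimum number of colors in a star edge-coloring of $G$. $C_m$ denotes the cycle on $m$ vertices. $G \,\square\, H$ denotes the Cartesian product: vertex set $V(G)\times V(H)$, with $(u,v)(u',v')$ an edge iff either $uu'\in E(G)$ and $v=v'$, or $u=u'$ and $vv'\in E(H)$. *)

(* Defs.v *)
From mathcomp Require Import all_boot.

Set Implicit Arguments.
Unset Strict Implicit.
Unset Printing Implicit Defensive.

Record sgraph := SGraph {
  vert : finType;
  adj : rel vert;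
  adj_sym : symmetric adj;
  adj_irrefl : irreflexive adj }.

Definition edge_set (G : sgraph) : {set {set vert G}} :=
  [set [set u; v] | u in [set: vert G], v in [set w | adj u w]].

Definition edge (G : sgraph) := {e : {set vert G} | e \in edge_set G}.

Definition path_edges (T : finType) (x : T) (p : seq T) : seq {set T} :=
  pairmap (fun u v => [set u; v]) x p.

Definition cycle_edges (T : finType) (s : seq T) : seq {set T} :=
  if s is x :: p then path_edges x (rcons p x) else [::].

Section EdgeColoring.
Variables (G : sgraph) (C : finType) (c : edge G -> C).

Definition proper_edge_coloring : bool :=
  [forall e : edge G, forall f : edge G,
     (e != f) && ~~ [disjoint val e & val f] ==> (c e != c f)].

Definition bichromatic (s : seq {set vert G}) : bool :=
  #|[set c e | e in [set e : edge G | val e \in s]]| == 2.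

Definition star_edge_coloring : bool :=
  [&& proper_edge_coloring,
      [forall x : vert G, forall p : 4.-tuple (vert G),
         path (@adj G) x p && uniq (x :: p) ==> ~~ bichromatic (path_edges x p)]
    & [forall s : 4.-tuple (vert G),
         cycle (@adj G) s && uniq s ==> ~~ bichromatic (cycle_edges s)]].

End EdgeColoring.

Definition star_edge_colorable (G : sgraph) (q : nat) : bool :=
  [exists c : {ffun edge G -> 'I_q}, star_edge_coloring c].

Lemma edge_setP (G : sgraph) (u v : vert G) :
  adj u v -> [set u; v] \in edge_set G.
Proof. by move=> uv; apply/imset2P; exists u v; rewrite ?inE. Qed.

Lemma inj_not_bichromatic (G : sgraph) (C : finType) (c : edge G -> C)
    (s : seq {set vert G}) (x y z t : vert G) :
    injective c -> adj x y -> adj y z -> adj z t -> uniq [:: x; y; z; t] ->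
    {subset [:: [set x; y]; [set y; z]; [set z; t]] <= s} ->
  ~~ bichromatic c s.
Proof.
move=> c_inj xy yz zt; rewrite /= !inE !negb_or.
case/and4P=> /and3P[nxy nxz nxt] /andP[nyz nyt] nzt _ sub.
rewrite /bichromatic card_imset // neq_ltn; apply/orP; right.
pose e1 : edge G := exist (fun e => e \in edge_set G) _ (edge_setP xy).
pose e2 : edge G := exist (fun e => e \in edge_set G) _ (edge_setP yz).
pose e3 : edge G := exist (fun e => e \in edge_set G) _ (edge_setP zt).
apply/card_gt2P; exists e1, e2, e3; split.
- by split; rewrite inE /=; apply: sub; rewrite !inE eqxx ?orbT.
- have neq (a b : edge G) w : w \in val a -> w \notin val b -> a != b.
    by move=> wa; apply: contraNneq => <-.
  split.
  + by apply: (neq _ _ x); rewrite /= !inE ?eqxx // negb_or nxy.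
  + by apply: (neq _ _ y); rewrite /= !inE ?eqxx // negb_or nyz.
  + by apply: (neq _ _ t);
      rewrite /= !inE ?eqxx ?orbT // negb_or ![t == _]eq_sym nxt.
Qed.

Lemma star_edge_colorable_ex (G : sgraph) : exists q, star_edge_colorable G q.
Proof.
exists #|{: edge G}|; apply/existsP; exists [ffun e => enum_rank e].
set c := (X in star_edge_coloring X).
have c_inj : injective c by move=> e f; rewrite /c !ffunE => /enum_rank_inj.
apply/and3P; split.
- apply/forallP=> e; apply/forallP=> f; apply/implyP=> /andP[nef _].
  by rewrite (inj_eq c_inj).
- apply/forallP=> x; apply/forallP=> -[[|a [|b [|d [|f []]]]] //= szp].
  apply/implyP=> /andP[/and5P[xa ab bd df _] U].
  apply: (inj_not_bichromatic c_inj xa ab bd).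
    have : uniq ([:: x; a; b; d] ++ [:: f]) by exact: U.
    by rewrite cat_uniq => /andP[].
  by move=> g; rewrite !inE => /or3P[] ->; rewrite ?orbT.
- apply/forallP=> -[[|a [|b [|d [|f []]]]] //= szp].
  apply/implyP=> /andP[/and5P[ab bd df _ _] U].
  apply: (inj_not_bichromatic c_inj ab bd df U).
  by move=> g; rewrite !inE => /or3P[] ->; rewrite ?orbT.
Qed.

Definition star_chromatic_index (G : sgraph) : nat :=
  ex_minn (star_edge_colorable_ex G).

(* This is the cycle graph only for m >= 3 (for m = 2 it is a single edge). The
   conjunct i != j removes the loop that would appear when m = 1.             *)
Definition cycle_adj (m : nat) : rel 'I_m :=
  fun i j => (i != j) && ((j == ordS i) || (i == ordS j)).

Lemma cycle_adj_sym m : symmetric (@cycle_adj m).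
Proof. by move=> i j; rewrite /cycle_adj eq_sym orbC. Qed.

Lemma cycle_adj_irrefl m : irreflexive (@cycle_adj m).
Proof. by move=> i; rewrite /cycle_adj eqxx. Qed.

Definition cycle_graph (m : nat) : sgraph :=
  SGraph (@cycle_adj_sym m) (@cycle_adj_irrefl m).

Section CartesianProduct.
Variables G H : sgraph.

Definition box_adj : rel (vert G * vert H) :=
  fun x y => adj x.1 y.1 && (x.2 == y.2) || (x.1 == y.1) && adj x.2 y.2.

Lemma box_adj_sym : symmetric box_adj.
Proof.
move=> x y; rewrite /box_adj adj_sym eq_sym.
by rewrite [x.1 == _]eq_sym [adj x.2 _]adj_sym.
Qed.

Lemma box_adj_irrefl : irreflexive box_adj.
Proof. by move=> x; rewrite /box_adj !adj_irrefl andbF. Qed.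

Definition box_product : sgraph := SGraph box_adj_sym box_adj_irrefl.

End CartesianProduct.

(* Main.v *)
(** Lower bound: in a [d]-regular graph, a star edge-coloring with [q] colors
    forces [3 d <= 2 q + 1] by a double count around a single vertex; for [d = 4]
    this gives [q >= 6].

    Upper bound: the rows of the torus are of ten types. Types 0-3 and 4-9 form
    blocks of four and six rows, which can be stacked in any order, so that
    every even height at least 4 is reached. Rows have horizontal period 4.
    A walk of four edges stays within two edges of its middle vertex, hence
    only finitely many local configurations have to be inspected. *)

Require Import Defs.
From mathcomp Require Import all_boot.
From mathcomp Require Import zify.

Set Implicit Arguments.
Unset Strict Implicit.
Unset Printing Implicit Defensive.

(** * Star edge-colorings in terms of walks *)

Section WalkColors.
Variables (G : sgraph) (C : finType) (c : edge G -> C).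
Implicit Types u v w x y z t : vert G.

(** Total on vertex sets, so that walks need not carry proofs that their steps are edges. *)
Definition set_color (A : {set vert G}) : option C := omap c (insub A).

(* [None] when [u] and [v] are not adjacent. *)
Definition ecol u v : option C := set_color [set u; v].

Lemma ecolC u v : ecol u v = ecol v u.
Proof. by rewrite /ecol setUC. Qed.

Lemma set_color_val (e : edge G) : set_color (val e) = Some (c e).
Proof. by rewrite /set_color valK. Qed.

Definition mk_edge A (AE : A \in edge_set G) : edge G :=
  exist (fun e => e \in edge_set G) A AE.

Lemma set_color_mk A (AE : A \in edge_set G) :
  set_color A = Some (c (mk_edge AE)).
Proof. by rewrite -set_color_val. Qed.

Lemma bichromaticE (s : seq {set vert G}) : {subset s <= edge_set G} ->
  bichromatic c s = (size (undup (map set_color s)) == 2).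
Proof.
move=> sE; rewrite /bichromatic -(card_imset _ Some_inj).
rewrite -(card_uniqP (undup_uniq _)); congr (_ == 2); apply: eq_card => a.
rewrite mem_undup; apply/imsetP/mapP => [[b /imsetP[e]] | [A As ->]].
  by rewrite inE => es -> ->; exists (val e); rewrite ?set_color_val.
pose e := mk_edge (sE _ As).
exists (c e); last by rewrite -set_color_val.
by apply/imsetP; exists e; rewrite ?inE.
Qed.

Lemma size_undup4 (T : eqType) (a b d e : T) : a != b -> b != d -> d != e ->
  (size (undup [:: a; b; d; e]) == 2) = (a == d) && (b == e).
Proof.
move=> ab bd de /=; rewrite !inE (negPf ab) (negPf bd) (negPf de) /=.
have [eq_ad|] := eqVneq a d; have [eq_be|] := eqVneq b e => //=.
  by rewrite -eq_be (negPf ab).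
by case: (a == e).
Qed.

Definition proper_walks := forall x y z, adj x y -> adj y z -> x != z ->
  ecol x y != ecol y z.

(** Only backtracking is excluded: [x = w] is allowed, so paths and 4-cycles are covered by one
    condition. *)
Definition star_walks := forall x y z t w,
  adj x y -> adj y z -> adj z t -> adj t w -> x != z -> y != t -> z != w ->
  ~~ ((ecol x y == ecol z t) && (ecol y z == ecol t w)).

Lemma edgeP (e : edge G) v : v \in val e ->
  exists2 u, adj u v & val e = [set u; v].
Proof.
case: e => A /= /imset2P[x y _]; rewrite inE => xy -> /set2P[] ->.
  by exists y; rewrite 1?adj_sym // setUC.
by exists x.
Qed.

Lemma proper_edge_coloringP : reflect proper_walks (proper_edge_coloring c).
Proof.
apply: (iffP idP) => [/forallP pc x y z xy yz xz | pc].
  have /implyP := forallP (pc (mk_edge (edge_setP xy))) (mk_edge (edge_setP yz)).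
  rewrite /ecol (set_color_mk (edge_setP xy)) (set_color_mk (edge_setP yz)).
  move=> H; apply/eqP => -[]; apply/eqP/H.
  apply/andP; split; last first.
    by apply/pred0Pn; exists y; rewrite /= !inE eqxx ?orbT.
  apply/eqP => /(congr1 val) /= /setP/(_ x); rewrite !inE eqxx (negPf xz) orbF.
  by move/esym/eqP => eq_xy; move: (xy); rewrite eq_xy adj_irrefl.
apply/forallP=> e; apply/forallP=> f; apply/implyP=> /andP[nef].
case/pred0Pn=> v /andP[ve vf].
have [u uv def_e] := edgeP ve; have [w wv def_f] := edgeP vf.
apply: contraNneq nef => cef; apply/eqP/val_inj; rewrite def_e def_f.
have [-> // | uw] := eqVneq u w; rewrite adj_sym in wv.
have := pc _ _ _ uv wv uw.
by rewrite [ecol v w]ecolC /ecol -def_e -def_f !set_color_val cef eqxx.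
Qed.

Lemma bichromatic_walk x y z t w : proper_walks ->
    adj x y -> adj y z -> adj z t -> adj t w -> x != z -> y != t -> z != w ->
  bichromatic c [:: [set x; y]; [set y; z]; [set z; t]; [set t; w]] =
    (ecol x y == ecol z t) && (ecol y z == ecol t w).
Proof.
move=> pc xy yz zt tw xz yt zw; rewrite bichromaticE; last first.
  by move=> A; rewrite !inE => /or4P[] /eqP ->; apply: edge_setP.
by apply: size_undup4; apply: pc.
Qed.

(** Under properness, a non-backtracking walk of four edges with alternating colors can repeat no
    vertices other than its two ends. *)
Lemma star_edge_coloringP :
  reflect (proper_walks /\ star_walks) (star_edge_coloring c).
Proof.
apply: (iffP and3P) => [[/proper_edge_coloringP pc /forallP sp /forallP sc]|].
  split=> // x y z t w xy yz zt tw xz yt zw; apply/negP => bi.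
  have adjN (a b : vert G) : adj a b -> a != b.
    by apply: contraTneq => ->; rewrite adj_irrefl.
  have /andP[/eqP xyzt /eqP yztw] := bi.
  (* If [x = t], the equally colored edges [xy] and [zt] would meet at [x]; likewise below for
     [y = w]. *)
  have xt : x != t.
    apply/eqP => xt; have yx : adj y x by rewrite adj_sym.
    have xz' : adj x z by rewrite adj_sym xt.
    have := pc _ _ _ yx xz' (adjN _ _ yz).
    by rewrite ecolC xyzt -xt ecolC eqxx.
  have yw : y != w.
    apply/eqP => yw; have zy : adj z y by rewrite adj_sym.
    have yt' : adj y t by rewrite adj_sym yw.
    have := pc _ _ _ zy yt' (adjN _ _ zt).
    by rewrite ecolC yztw -yw ecolC eqxx.
  rewrite -(bichromatic_walk pc xy yz zt tw) // in bi.
  (* The walk is a 4-cycle if its ends agree, and a path otherwise. *)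
  have [eq_xw | xw] := eqVneq x w.
    rewrite -eq_xw in bi tw.
    apply: negP bi; apply: (implyP (sc [tuple x; y; z; t])).
    rewrite /= xy yz zt tw /= !inE !negb_or.
    by rewrite xz xt yt !adjN.
  apply: negP bi; apply: (implyP (forallP (sp x) [tuple y; z; t; w])).
  rewrite /= xy yz zt tw /= !inE !negb_or xz xt xw yt yw zw.
  by rewrite !adjN.
case=> pc sw; split; first exact/proper_edge_coloringP.
  apply/forallP=> x; apply/forallP=> -[[|y [|z [|t [|w []]]]] //= _].
  apply/implyP=> /andP[/and5P[xy yz zt tw _]].
  rewrite /= !inE !negb_or => /and5P[/and4P[_ xz _ _] /and3P[_ yt _]].
  case/andP=> _ zw _ _.
  by rewrite /path_edges /= bichromatic_walk ?sw.
apply/forallP=> -[[|x [|y [|z [|t []]]]] //= _].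
apply/implyP=> /andP[/and5P[xy yz zt tx _]].
rewrite /= !inE !negb_or => /and4P[/and3P[_ xz _] /andP[_ yt] _ _].
by rewrite /path_edges /= bichromatic_walk ?sw // eq_sym.
Qed.

End WalkColors.

Lemma set2_eq (T : finType) (u v x y : T) : [set u; v] = [set x; y] ->
  (x = u /\ y = v) \/ (x = v /\ y = u).
Proof.
move=> eq_s; have /set2P xuv : x \in [set u; v] by rewrite eq_s set21.
have /set2P yuv : y \in [set u; v] by rewrite eq_s set22.
have /set2P uxy : u \in [set x; y] by rewrite -eq_s set21.
have /set2P vxy : v \in [set x; y] by rewrite -eq_s set22.
by case: xuv; case: yuv; case: uxy; case: vxy => *; subst; auto.
Qed.

(** * Edge-colorings from symmetric functions of two vertices *)

Section SymmetricColoring.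
Variables (G : sgraph) (q : nat) (col : vert G -> vert G -> 'I_q).
Hypothesis colC : forall u v, adj u v -> col u v = col v u.

Lemma edge_ends (e : edge G) :
  {p : vert G * vert G | adj p.1 p.2 & val e = [set p.1; p.2]}.
Proof.
pose P (p : vert G * vert G) := adj p.1 p.2 && (val e == [set p.1; p.2]).
have [p /andP[pa /eqP pe] | noP] := pickP P; first by exists p.
exfalso; case: e @P noP => A /= eA noP.
case/imset2P: (eA) => x y _; rewrite inE => xy def_A.
by have := noP (x, y); rewrite /= xy def_A eqxx.
Qed.

(** The order of the chosen ends is arbitrary; [colC] makes it irrelevant. *)
Definition edge_color_of (e : edge G) : 'I_q :=
  let p := s2val (edge_ends e) in col p.1 p.2.

Lemma ecol_edge_color_of u v : adj u v ->
  ecol edge_color_of u v = Some (col u v).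
Proof.
move=> uv; rewrite /ecol (set_color_mk _ (edge_setP uv)); congr Some.
rewrite /edge_color_of; case: edge_ends => -[x y] /= xy /set2_eq[] [-> ->] //.
by rewrite -colC.
Qed.

Lemma star_edge_colorable_of :
  (forall x y z, adj x y -> adj y z -> x != z -> col x y != col y z) ->
  (forall x y z t w,
     adj x y -> adj y z -> adj z t -> adj t w -> x != z -> y != t -> z != w ->
     ~~ ((col x y == col z t) && (col y z == col t w))) ->
  star_edge_colorable G q.
Proof.
move=> pc sw; apply/existsP; exists (finfun edge_color_of).
have colE u v : adj u v -> ecol (finfun edge_color_of) u v = Some (col u v).
  move=> uv; rewrite -ecol_edge_color_of // /ecol.
  by rewrite !(set_color_mk _ (edge_setP uv)) ffunE.
apply/star_edge_coloringP; split=> [x y z xy yz xz | x y z t w xy yz zt tw *].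
  by rewrite !colE // (inj_eq Some_inj) pc.
by rewrite !colE // !(inj_eq Some_inj) sw.
Qed.

End SymmetricColoring.

(** * Lower bound for regular graphs *)

Section RegularLowerBound.
Variables (G : sgraph) (d q : nat) (u : vert G).
Hypothesis regG : forall v : vert G, #|[set w | adj v w]| = d.
Hypothesis colG : star_edge_colorable G q.

(* Let N be the neighbourhood of u and S x the set of colours at x. For v in N,
   every colour b of S u :&: S v other than the colour a of uv sits on an edge
   ux, and a is missing at x, for otherwise a walk a b a b would appear through
   x, u, v. Count in two ways the pairs (v, x) in N such that the colour of uv is
   missing at x. *)
Lemma star_colors_regular : 3 * d <= (2 * q).+1.
Proof.
case/existsP: colG => c /star_edge_coloringP[pc sw].
have [-> // | d_gt0] := posnP d.
pose N (v : vert G) := [set w | adj v w].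
pose S v := ecol c v @: N v.
have injN v : {in N v &, injective (ecol c v)}.
  move=> x y; rewrite !inE => vx vy eq_c; apply/eqP/negPn/negP => nxy.
  have := pc x v y; rewrite adj_sym => /(_ vx vy nxy).
  by rewrite ecolC eq_c eqxx.
have cardS v : #|S v| = d by rewrite card_in_imset ?regG.
(* Leaving out [None] gives exactly [q] colors. *)
pose K : {set option 'I_q} := Some @: setT.
have cardK : #|K| = q by rewrite card_imset ?cardsT ?card_ord //; apply: Some_inj.
have SK v : S v \subset K.
  apply/subsetP => a /imsetP[w]; rewrite inE => vw ->.
  by rewrite /ecol (set_color_mk _ (edge_setP vw)) imset_f.
pose M v := [set x in N u | ecol c u v \notin S x].
have M_ge v : v \in N u -> 2 * d <= #|M v| + q.+1.
  move=> vN; pose B := (S u :&: S v) :\ ecol c u v.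
  have uv : adj u v by rewrite inE in vN.
  have leB : #|B| <= #|M v|.
    rewrite -(card_in_imset (f := ecol c u) (D := mem (M v))); last first.
      by move=> x y /setIdP[xN _] /setIdP[yN _]; apply: injN.
    apply/subset_leq_card/subsetP => b /setD1P[ba /setIP[/imsetP[x xN def_b]]].
    case/imsetP=> y; rewrite inE => vy def_b'.
    have ux : adj u x by rewrite inE in xN.
    apply/imsetP; exists x => //; rewrite inE xN /=.
    apply/imsetP => -[z]; rewrite inE => xz def_a.
    have zx : adj z x by rewrite adj_sym.
    have xu : adj x u by rewrite adj_sym.
    have zu : z != u.
      by apply: contraNneq ba => zu; rewrite def_b def_a zu ecolC.
    have xv : x != v by apply: contraNneq ba => <-; rewrite def_b.
    have uy : u != y.
      by apply: contraNneq ba => uy; rewrite def_b' -uy ecolC.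
    have := sw _ _ _ _ _ zx xu uv vy zu xv uy.
    by rewrite ecolC -def_a eqxx ecolC -def_b -def_b' eqxx.
  have aI : ecol c u v \in S u :&: S v.
    by rewrite inE imset_f // ecolC imset_f // inE adj_sym.
  (* Two [d]-sets among [q] colors share at least [2d - q]; one of these is the color of [uv]. *)
  have cardB := cardsD1 (ecol c u v) (S u :&: S v); rewrite aI -/B in cardB.
  have cardU := cardsUI (S u) (S v); rewrite !cardS in cardU.
  have leU : #|S u :|: S v| <= q.
    by rewrite -[X in _ <= X]cardK subset_leq_card // subUset !SK.
  by lia.
(* Exactly [q - d] colors are missing at [x], and each comes from at most one [v]. *)
have M_le x : x \in N u -> #|[set v in N u | ecol c u v \notin S x]| + d <= q.
  move=> xN; rewrite -(card_in_imset (f := ecol c u)); last first.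
    by move=> y z /setIdP[yN _] /setIdP[zN _]; apply: injN.
  rewrite -(cardS x) -[X in _ <= X]cardK -(cardsID (S x) K) addnC.
  rewrite (setIidPr (SK x)) leq_add2l; apply/subset_leq_card/subsetP => a.
  case/imsetP => v /setIdP[vN aS] ->; rewrite inE aS (subsetP (SK u)) //.
  by rewrite imset_f.
have count : \sum_(v in N u) #|M v| =
    \sum_(x in N u) #|[set v in N u | ecol c u v \notin S x]|.
  pose P v x := ecol c u v \notin S x.
  rewrite (eq_bigr (fun v => \sum_(x in N u) P v x)); last first.
    move=> v _; rewrite -sum1_card -big_mkcondr /=.
    by apply: eq_bigl => x; rewrite !inE.
  rewrite exchange_big /=; apply: eq_bigr => x _.
  rewrite -sum1_card -big_mkcondr /=.
  by apply: eq_bigl => v; rewrite !inE.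
have constN j : d * j = \sum_(v in N u) j by rewrite sum_nat_const regG.
have ge : d * (2 * d) <= \sum_(v in N u) #|M v| + d * q.+1.
  rewrite (constN (2 * d)) (constN q.+1) -big_split /=.
  by apply: leq_sum => v; apply: M_ge.
have le : \sum_(v in N u) #|M v| + d * d <= d * q.
  rewrite count (constN d) (constN q) -big_split /=.
  by apply: leq_sum => x; apply: M_le.
have : d * (3 * d) <= d * (2 * q).+1 by nia.
by rewrite leq_pmul2l.
Qed.

End RegularLowerBound.

(* The components tell whether the direction is vertical, resp. forward. *)
Definition dir := (bool * bool)%type.

Definition opp (d : dir) : dir := (d.1, ~~ d.2).

Definition dirs : seq dir :=
  [:: (false, false); (false, true); (true, false); (true, true)].

Lemma mem_dirs d : d \in dirs.
Proof. by case: d => [[] []]. Qed.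

(** * Directions and colorings on the torus *)

Section Torus.
Variables m n : nat.
Hypotheses (m_gt2 : 2 < m) (n_gt2 : 2 < n).

Local Notation torus := (box_product (cycle_graph m) (cycle_graph n)).

Definition step (u : 'I_m * 'I_n) (d : dir) : 'I_m * 'I_n :=
  match d with
  | (false, true) => (ordS u.1, u.2)
  | (false, false) => (ord_pred u.1, u.2)
  | (true, true) => (u.1, ordS u.2)
  | (true, false) => (u.1, ord_pred u.2)
  end.

Lemma step_opp u d : step (step u d) (opp d) = u.
Proof. by case: u d => i j [[] []]; rewrite /= ?ordSK ?ord_predK. Qed.

Lemma ordS_neq p (i : 'I_p) : 1 < p -> i != ordS i.
Proof.
case: i => i lt_ip p_gt1; rewrite -val_eqE /=.
have [ip | ne_ip] := eqVneq i.+1 p; first by rewrite ip modnn; lia.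
by rewrite modn_small; lia.
Qed.

Lemma ordS2_neq p (i : 'I_p) : 2 < p -> ordS (ordS i) != i.
Proof.
case: i => i lt_ip p_gt2; rewrite -val_eqE /= -addn1 modnDml addn1.
have [le_p | lt_p] := leqP p i.+2; last by rewrite modn_small; lia.
by rewrite -(subnK le_p) modnDr modn_small; lia.
Qed.

Lemma ord_pred_neq p (i : 'I_p) : 1 < p -> i != ord_pred i.
Proof. by move=> /ordS_neq-/(_ (ord_pred i)); rewrite ord_predK eq_sym. Qed.

Lemma ordS_pred_neq p (i : 'I_p) : 2 < p -> ordS i != ord_pred i.
Proof. by move=> /ordS2_neq-/(_ (ord_pred i)); rewrite ord_predK. Qed.

(** Cycle lengths above 2 keep the forward and backward neighbors apart. *)
Lemma step_inj u : injective (step u).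
Proof.
have m1 := ltnW m_gt2; have n1 := ltnW n_gt2.
have := ordS_pred_neq u.1 m_gt2; have := ordS_pred_neq u.2 n_gt2.
have := ordS_neq u.1 m1; have := ordS_neq u.2 n1.
have := ord_pred_neq u.1 m1; have := ord_pred_neq u.2 n1.
case: u => i j /= /eqP h1 /eqP h2 /eqP h3 /eqP h4 /eqP h5 /eqP h6.
move=> [[] []] [[] []] //= eq_s; have := congr1 snd eq_s;
  by have := congr1 fst eq_s => /=; congruence.
Qed.

Lemma adj_stepP u v : reflect (exists d, v = step u d) (@adj torus u v).
Proof.
have m1 := ltnW m_gt2; have n1 := ltnW n_gt2.
apply: (iffP idP) => [|[d ->]].
  case: u v => i j [i' j']; rewrite /= /box_adj /= /cycle_adj.
  case/orP => [/andP[/andP[_ /orP[]/eqP ->] /eqP ->] |].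
  - by exists (false, true).
  - by exists (false, false); rewrite /= ordSK.
  case/andP=> /eqP -> /andP[_ /orP[]/eqP ->].
  - by exists (true, true).
  - by exists (true, false); rewrite /= ordSK.
case: d u => [[] []] [i j]; rewrite /= /box_adj /= /cycle_adj ?ord_predK !eqxx.
- by rewrite ordS_neq ?orbT.
- by rewrite ord_pred_neq ?orbT.
- by rewrite ordS_neq.
- by rewrite ord_pred_neq ?orbT.
Qed.

Lemma torus_regular (u : vert torus) : #|[set w | adj u w]| = 4.
Proof.
transitivity #|[set step u d | d in [set: dir]]|.
  congr #|pred_of_set _|; apply/setP=> w; rewrite inE.
  apply/adj_stepP/imsetP => [[d ->] | [d _ ->]]; last by exists d.
  by exists d; rewrite ?inE.
by rewrite card_imset ?cardsT ?card_prod ?card_bool //; apply: step_inj.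
Qed.

(* A colouring given by the colour of the edge leaving each vertex in each
   direction. *)
Lemma torus_colorable q (ec : 'I_m * 'I_n -> dir -> 'I_q) :
  (forall u d, ec (step u d) (opp d) = ec u d) ->
  (forall u, injective (ec u)) ->
  (forall u d d' e e', d != e -> d' != opp d -> e' != opp e ->
     ~~ ((ec (step u d) d' == ec u e) && (ec u d == ec (step u e) e'))) ->
  star_edge_colorable torus q.
Proof.
move=> ecC ec_inj ec_star.
have u0 : 'I_m * 'I_n := (Ordinal (ltnW (ltnW m_gt2)), Ordinal (ltnW (ltnW n_gt2))).
pose c0 := ec u0 (true, true).
(* The direction is unique by [step_inj]; [c0] is a dummy value for non-adjacent pairs. *)
pose col (u v : vert torus) :=
  if [pick d | v == step u d] is Some d then ec u d else c0.
have colE u d : col u (step u d) = ec u d.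
  rewrite /col; case: pickP => [e /eqP/step_inj -> // | /(_ d)].
  by rewrite eqxx.
have colE' u d : col (step u d) u = ec u d.
  by rewrite -{2}(step_opp u d) colE ecC.
have neq_opp u d d' : u != step (step u d) d' -> d' != opp d.
  by apply: contraNneq => ->; rewrite step_opp.
apply: (@star_edge_colorable_of torus q col).
- by move=> u v /adj_stepP[d ->]; rewrite colE colE'.
- move=> x y z; rewrite adj_sym => /adj_stepP[d ->] /adj_stepP[e ->] ne.
  rewrite colE' colE (inj_eq (@ec_inj y)).
  by apply: contraNneq ne => ->.
(* The walk is read outwards from its middle vertex [z]: [d], [d'] lead to [y], [x] and [e], [e'] to
   [t], [w]. *)
move=> x y z t w xy yz /adj_stepP[e ->] /adj_stepP[e' ->].
rewrite adj_sym in yz; case/adj_stepP: yz xy => d ->.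
rewrite adj_sym => /adj_stepP[d' ->] xz yt zw.
rewrite !colE !colE'; apply: ec_star.
- by apply: contraNneq yt => ->.
- by rewrite eq_sym in xz; apply: neq_opp xz.
- exact: neq_opp zw.
Qed.

End Torus.

(** * The periodic pattern and its finite check *)

Definition hshift : seq nat := [:: 0; 1; 2; 3; 2; 3; 3; 0; 3; 2].
Definition vshift : seq nat := [:: 2; 0; 0; 1; 0; 0; 1; 0; 0; 1].

(* [hcol x r] and [vcol x r] color the edges that leave the vertex in column [x]
   and a row of type [r] towards the next column, resp. the next row; the two
   shift tables were found by computer search. *)
Definition hcol (x r : nat) : nat := (x + nth 0 hshift r) %% 4.

Definition vcol (x r : nat) : nat :=
  if odd r then 4 + (x + nth 0 vshift r) %% 2 else (x + nth 0 vshift r) %% 4.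

(** Types 3 and 9 end a block, after which either block may start. *)
Definition next_rows (r : nat) : seq nat :=
  if (r == 3) || (r == 9) then [:: 0; 4] else [:: r.+1].

(* Colors of the edges at distance 0 and 1 from a vertex in column [x], where
   [r0], [r1], [r2], [r3] are the types of consecutive rows and the vertex lies in
   the row of type [r2]. Column [x + 3] stands for [x - 1] modulo 4. *)
Definition near_color (x r1 r2 : nat) (d : dir) : nat :=
  match d with
  | (false, true) => hcol x r2
  | (false, false) => hcol (x + 3) r2
  | (true, true) => vcol x r2
  | (true, false) => vcol x r1
  end.

Definition far_color (x r0 r1 r2 r3 : nat) (d : dir) : dir -> nat :=
  match d with
  | (false, true) => near_color (x + 1) r1 r2
  | (false, false) => near_color (x + 3) r1 r2
  | (true, true) => near_color x r2 r3
  | (true, false) => near_color x r0 r1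
  end.

Definition local_ok (x r0 r1 r2 r3 : nat) : bool :=
  let near := near_color x r1 r2 in
  let far := far_color x r0 r1 r2 r3 in
  all (fun d => all (fun e => (d == e) ||
    (near d != near e) &&
    all (fun d' => all (fun e' => [|| d' == opp d, e' == opp e |
      ~~ ((far d d' == near e) && (near d == far e e'))]) dirs) dirs) dirs) dirs.

Lemma local_check :
  all (fun x => all (fun r0 => all (fun r1 => all (fun r2 => all (fun r3 =>
    local_ok x r0 r1 r2 r3)
  (next_rows r2)) (next_rows r1)) (next_rows r0)) (iota 0 10)) (iota 0 4).
Proof. by vm_compute. Qed.

Lemma near_color_mod x y r1 r2 d : x = y %[mod 4] ->
  near_color x r1 r2 d = near_color y r1 r2 d.
Proof.
have hcolE a b r : a = b %[mod 4] -> hcol a r = hcol b r.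
  by rewrite /hcol => ab; lia.
have vcolE a b r : a = b %[mod 4] -> vcol a r = vcol b r.
  by rewrite /vcol => ab; case: ifP => _; lia.
move=> xy; case: d => [[] []] /=; [exact: vcolE | exact: vcolE | exact: hcolE |].
by apply: hcolE; lia.
Qed.

Lemma far_color_mod x y r0 r1 r2 r3 d d' : x = y %[mod 4] ->
  far_color x r0 r1 r2 r3 d d' = far_color y r0 r1 r2 r3 d d'.
Proof. by move=> xy; case: d => [[] []] /=; apply: near_color_mod; lia. Qed.

(** Colors 4 and 5 occur only on vertical edges leaving rows of odd type; all other edges use 0 to
    3. *)
Lemma near_color_lt6 x r1 r2 d : near_color x r1 r2 d < 6.
Proof.
have h a r : hcol a r < 6 by rewrite /hcol; lia.
have v a r : vcol a r < 6 by rewrite /vcol; case: ifP => _; lia.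
by case: d => [[] []] /=.
Qed.

Lemma local_okP x r0 r1 r2 r3 d e : r0 < 10 -> r1 \in next_rows r0 ->
    r2 \in next_rows r1 -> r3 \in next_rows r2 -> d != e ->
  let near := near_color x r1 r2 in
  let far := far_color x r0 r1 r2 r3 in
  near d != near e /\
  forall d' e', d' != opp d -> e' != opp e ->
    ~~ ((far d d' == near e) && (near d == far e e')).
Proof.
move=> lt_r0 h1 h2 h3 de near far.
have xmod : x = x %% 4 %[mod 4] by rewrite modn_mod.
have x4 : x %% 4 \in iota 0 4 by rewrite mem_iota ltn_pmod.
have r010 : r0 \in iota 0 10 by rewrite mem_iota.
have /allP/(_ _ x4)/allP/(_ _ r010)/allP/(_ _ h1)/allP/(_ _ h2) := local_check.
move/allP/(_ _ h3)/allP/(_ _ (mem_dirs d))/allP/(_ _ (mem_dirs e)).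
rewrite (negPf de) -!(near_color_mod _ _ _ xmod) -/near => /andP[-> ok].
split=> // d' e' nd' ne'.
have /allP/(_ _ (mem_dirs d'))/allP/(_ _ (mem_dirs e')) := ok.
by rewrite (negPf nd') (negPf ne') -!(far_color_mod _ _ _ _ _ _ xmod).
Qed.

(** * The 6-coloring of the torus *)

Section TorusColoring.
Variables k l : nat.
Hypotheses (k_gt0 : 0 < k) (l_gt1 : 1 < l).

(** For odd [l], one block of six rows comes first, leaving [2 * l - 6], a multiple of 4; for even
    [l], blocks of four suffice. *)
Definition row_type (j : nat) : nat :=
  let s := if odd l then 6 else 0 in if j < s then 4 + j else (j - s) %% 4.

Lemma row_type_lt10 j : row_type j < 10.
Proof. by rewrite /row_type /=; case: ifP; case: (odd l); lia. Qed.

Lemma next_row_type (j : 'I_(2 * l)) :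
  row_type (ordS j) \in next_rows (row_type j).
Proof.
case: j => j lt_j /=.
have -> : j.+1 %% (2 * l) = if j.+1 == 2 * l then 0 else j.+1.
  by case: eqP => [-> | ne]; rewrite ?modnn // modn_small //; lia.
rewrite /row_type /=; set s := if odd l then 6 else 0.
have s_cases : s = 6 /\ odd l \/ s = 0 /\ ~~ odd l.
  by rewrite /s; case: (odd l); auto.
rewrite /next_rows; case: (j.+1 =P 2 * l) => [eq_j | ne_j].
  (* The last row lies in the six-row block only if [l = 3], when that block is the whole height. *)
  have -> : (j < s) = (2 * l == s) by lia.
  by case: (2 * l =P s) => eq_s; case: (ltnP 0 s) => s_gt0; case: ifP => ?;
     rewrite !inE; lia.
by case: (ltnP j.+1 s) => lt_js'; case: (ltnP j s) => lt_js; case: ifP => ?;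
   rewrite !inE; lia.
Qed.

Definition torus_color (u : 'I_(4 * k) * 'I_(2 * l)) (d : dir) : nat :=
  near_color u.1 (row_type (ord_pred u.2)) (row_type u.2) d.

(** As 4 divides the length [4 * k], wrapping around is invisible modulo 4. *)
Lemma ordS_mod4 (i : 'I_(4 * k)) : ordS i = i + 1 %[mod 4].
Proof. by rewrite /= modn_dvdm ?dvdn_mulr // addn1. Qed.

Lemma ord_pred_mod4 (i : 'I_(4 * k)) : ord_pred i = i + 3 %[mod 4].
Proof. by rewrite /= modn_dvdm ?dvdn_mulr //; lia. Qed.

Lemma torus_color_step u d d' : torus_color (step u d) d' =
  far_color u.1 (row_type (ord_pred (ord_pred u.2))) (row_type (ord_pred u.2))
    (row_type u.2) (row_type (ordS u.2)) d d'.
Proof.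
case: u d => i j [[] []] //.
- rewrite /torus_color.
  exact: (congr1 (fun a : 'I_ _ => near_color i (row_type a) _ d') (ordSK j)).
- exact: (near_color_mod _ _ _ (ordS_mod4 i)).
- exact: (near_color_mod _ _ _ (ord_pred_mod4 i)).
Qed.

Lemma torus_color_opp u d : torus_color (step u d) (opp d) = torus_color u d.
Proof.
rewrite torus_color_step /torus_color; case: u d => i j [[] []] //=.
(* Going to the next column and back evaluates [hcol] at [i + 1 + 3], which is [i] modulo 4. *)
by rewrite /hcol; lia.
Qed.

Lemma torus_color_ok u d e : d != e ->
  torus_color u d != torus_color u e /\
  forall d' e', d' != opp d -> e' != opp e ->
  ~~ ((torus_color (step u d) d' == torus_color u e) &&
      (torus_color u d == torus_color (step u e) e')).
Proof.
move=> de.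
have h1 := next_row_type (ord_pred (ord_pred u.2)).
have h2 := next_row_type (ord_pred u.2); have h3 := next_row_type u.2.
rewrite !ord_predK in h1 h2.
have [near_ok far_ok] := local_okP u.1 (row_type_lt10 _) h1 h2 h3 de.
by split=> // d' e' nd' ne'; rewrite !torus_color_step; apply: far_ok.
Qed.

Lemma torus_6_colorable :
  star_edge_colorable (box_product (cycle_graph (4 * k)) (cycle_graph (2 * l))) 6.
Proof.
have lt6 u d : torus_color u d < 6 by apply: near_color_lt6.
pose ec u d : 'I_6 := inord (torus_color u d).
have ecE u d v e : (ec u d == ec v e) = (torus_color u d == torus_color v e).
  by rewrite -val_eqE /= !inordK.
apply: (@torus_colorable _ _ _ _ _ ec); rewrite ?leq_pmulr //; try lia.
- by move=> u d; apply/eqP; rewrite ecE torus_color_opp.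
- move=> u d e /eqP; rewrite ecE; apply: contraTeq => de.
  by case: (torus_color_ok u de).
- move=> u d d' e e' de nd' ne'; rewrite !ecE.
  by case: (torus_color_ok u de) => _; apply.
Qed.

End TorusColoring.

Theorem theorem13 (k l : nat) (hk : 1 <= k) (hl : 2 <= l) :
  star_chromatic_index
    (box_product (cycle_graph (4 * k)) (cycle_graph (2 * l))) = 6.
Proof.
have m_gt2 : 2 < 4 * k by lia.
have n_gt2 : 2 < 2 * l by lia.
rewrite /star_chromatic_index; case: ex_minnP => q col_q min_q.
apply/eqP; rewrite eqn_leq min_q ?torus_6_colorable //=.
have u : vert (box_product (cycle_graph (4 * k)) (cycle_graph (2 * l))).
  exact: (Ordinal (ltnW (ltnW m_gt2)), Ordinal (ltnW (ltnW n_gt2))).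
have := star_colors_regular u (torus_regular m_gt2 n_gt2) col_q.
by lia.
Qed.
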